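(* Let $\Gamma$ be a connected regular graph with vertex set $V$, degree $k$, $n$ vertices, and spectrum $\{\theta_0^{1},\theta_1^{m_1},\theta_2^{m_2},\theta_3^{m_3},\theta_4^{m_4}\}$ (exactly five distinct adjacency eigenvalues, exponents denoting multiplicities, $m_0=1$), where $\theta_0=k>\theta_1>\theta_2>\theta_3>\theta_4$, such that $\theta_1+\theta_4=\theta_2+\theta_3$, and let $\gamma_2$ be its preintersection number. Let $n_2(u)$ be the number of vertices at distance at most $2$ from $u$ in $\Gamma$, and let $\overline{n_2}=\frac1n\sum_{u\in V}n_2(u)$. Consider the polynomials $$s_1(x)=x^2-(\theta_2+\theta_3-\gamma_2)x+\theta_2\theta_3,$$ $$s_2(x)=x^2-(\theta_2+\theta_3)x+\gamma_2-\theta_2\theta_3.$$ Then, for $j=1,2$, $$\overline{n_2}\ge \Phi(\tau_j)=\frac{n\,(s_j(\theta_0)-\tau_j)^2}{\sum_{i=0}^4 m_i(s_j(\theta_i)-\tau_j)^2},\qquad\text{where}\quad \tau_j=\frac{s_j(\theta_0)\sum_{i=1}^4 m_i s_j(\theta_i)-\sum_{i=1}^4 m_i s_j(\theta_i)^2}{s_j(\theta_0)(n-1)-\sum_{i=1}^4 m_i s_j(\theta_i)}.$$ Moreover, equality holds with $j=1$ (respectively, with $j=2$) if and only if $\Gamma$ is a $2$-partially distance-regular graph and its distance-$2$ graph $\Gamma_2$ (respectively, its distance-$1$-or-$2$ graph $\Gamma_{1,2}$) is strongly regular.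
   Context: Graphs are finite, simple and undirected. The distance-$2$ graph $\Gamma_2$ (respectively, the distance-$1$-or-$2$ graph $\Gamma_{1,2}$) has the same vertices as $\Gamma$, two vertices being adjacent if and only if they are at distance $2$ (respectively, at distance $1$ or $2$) in $\Gamma$. A strongly regular graph is a regular graph, neither complete nor edgeless, in which the number of common neighbours of two distinct vertices depends only on whether they are adjacent or not; it is not required to be connected. Let $A$ be the adjacency matrix of a connected $k$-regular graph on $n$ vertices with distinct eigenvalues $\theta_0=k>\theta_1>\dots>\theta_d$ of multiplicities $m_0=1,m_1,\dots,m_d$. The predistance polynomials $p_0,\dots,p_d$, $\deg p_i=i$, are the orthogonal polynomials with respect to $\langle p,q\rangle=\frac1n\sum_{i=0}^d m_ip(\theta_i)q(\theta_i)$, normalized by $\langle p_i,p_i\rangle=p_i(k)$. The graph, with diameter $D$, is $m$-partially distance-regular ($0\le m\le D$) if $p_i(A)=A_i$ for every $i\le m$, where $A_i$ is the distance-$i$ matrix ($(A_i)_{uv}=1$ if $u,v$ are at distance $i$, and $0$ otherwise). One has $p_0=1$, $p_1=x$ and $p_2(x)=\frac1{\gamma_2}(x^2-\alpha_1x-k)$, where, with $\overline{\mathcal C}_{\ell}=\frac1n\sum_{i=0}^d m_i\theta_i^{\ell}$, $\alpha_1=\overline{\mathcal C}_3/\overline{\mathcal C}_2$ and the preintersection number $\gamma_2$ is $$\gamma_2=\frac{\overline{\mathcal C}_{3}^2-\overline{\mathcal C}_{4}k+k^3}{k(\overline{\mathcal C}_{3}+k-k^2)}.$$ *)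

(* Defs.v *)
(* A simple graph on a finite vertex set V is a symmetric irreflexive relation
   e : rel V; vertices index matrices through enum_val. *)
From mathcomp Require Import all_boot all_order all_algebra.
Set Implicit Arguments.
Unset Strict Implicit.
Unset Printing Implicit Defensive.
Import Order.TTheory GRing.Theory Num.Theory.
Local Open Scope ring_scope.

Section Graph.
Variables (V : finType) (e : rel V).

Definition connected_graph : Prop := forall u v, connect e u v.

Definition regular_graph (k : nat) : Prop := forall u, #|[set v | e u v]| = k.

(* Least length of a walk from u to v; the junk value #|V| stands for
   infinity when there is none (a shortest walk has length < #|V|). *)
Definition gdist (u v : V) : nat :=
  find (fun l => [exists p : l.-tuple V, path e u p && (last u p == v)])
       (iota 0 #|V|).

Definition diameter : nat := \max_(u : V) \max_(v : V) gdist u v.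

Definition dist2_graph : rel V := fun u v => gdist u v == 2%N.

Definition dist12_graph : rel V :=
  fun u v => (gdist u v == 1%N) || (gdist u v == 2%N).

Definition ball2_size (u : V) : nat := #|[set v | (gdist u v <= 2)%N]|.

(* Connectedness is not required. *)
Definition strongly_regular : Prop :=
  [/\ exists k, regular_graph k,
      exists u v, u != v /\ ~~ e u v,
      exists u v, e u v
    & exists a c : nat, forall u v, u != v ->
        #|[set w | e u w && e v w]| = if e u v then a else c].

Variable R : nzRingType.

Definition adj_mx : 'M[R]_#|V| := \matrix_(i, j) (e (enum_val i) (enum_val j))%:R.

Definition dist_mx (l : nat) : 'M[R]_#|V| :=
  \matrix_(i, j) (gdist (enum_val i) (enum_val j) == l)%:R.

Definition avg_ball2_size (F : fieldType) : F :=
  (\sum_(u : V) (ball2_size u)%:R) / #|V|%:R.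

End Graph.

Arguments adj_mx {V} e R.
Arguments dist_mx {V} e R l.
Arguments avg_ball2_size {V} e F.

(* horner_mx is only available in dimension n.+1, which #|V| is not
   syntactically. *)
Definition poly_mx (R : comNzRingType) (n : nat) (p : {poly R}) (A : 'M[R]_n) :
  'M[R]_n := \sum_(i < size p) p`_i *: A ^+ i.

Section Spectral.
Variables (R : rcfType) (d : nat).
Variables (theta : 'I_d.+1 -> R) (m : 'I_d.+1 -> nat).

Definition has_spectrum (n : nat) (A : 'M[R]_n) : Prop :=
  [/\ {homo theta : i j / (i < j)%N >-> j < i},
      forall i, (0 < m i)%N
    & char_poly A = \prod_i ('X - (theta i)%:P) ^+ m i].

Section Order.
Variable n : nat.

Definition spec_dot (p q : {poly R}) : R :=
  n%:R^-1 * \sum_i (m i)%:R * p.[theta i] * q.[theta i].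

Definition predistance_polys (k : nat) (p : 'I_d.+1 -> {poly R}) : Prop :=
  [/\ forall i, size (p i) = i.+1,
      forall i j, i != j -> spec_dot (p i) (p j) = 0
    & forall i, spec_dot (p i) (p i) = (p i).[k%:R]].

Definition avg_closed_walks (l : nat) : R :=
  n%:R^-1 * \sum_i (m i)%:R * theta i ^+ l.

Definition gamma2 (k : nat) : R :=
  let C := avg_closed_walks in let kr := k%:R in
  (C 3%N ^+ 2 - C 4%N * kr + kr ^+ 3) / (kr * (C 3%N + kr - kr ^+ 2)).

Definition Phi (s : {poly R}) (tau : R) : R :=
  n%:R * (s.[theta ord0] - tau) ^+ 2
  / \sum_i (m i)%:R * (s.[theta i] - tau) ^+ 2.

Definition tau_opt (s : {poly R}) : R :=
  let s0 := s.[theta ord0] in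
  let S1 := \sum_(i | i != ord0) (m i)%:R * s.[theta i] in
  let S2 := \sum_(i | i != ord0) (m i)%:R * s.[theta i] ^+ 2 in
  (s0 * S1 - S2) / (s0 * (n%:R - 1) - S1).

End Order.

(* theta, m are meant to be the spectrum of e, and k its degree.  The
   predistance polynomials of a connected regular graph exist and are unique,
   so the existential merely names them. *)
Definition partially_distance_regular (V : finType) (e : rel V) (k l : nat) :
    Prop :=
  (l <= diameter e)%N /\
  exists p : 'I_d.+1 -> {poly R}, predistance_polys #|V| k p /\
    forall i : 'I_d.+1, (i <= l)%N ->
      poly_mx (p i) (adj_mx e R) = dist_mx e R i.

End Spectral.

(* Numerals under theta are elements of the ring 'I_5; those below 5 denote the
   index itself.  The argument g stands for gamma2. *)
Section FiveEigenvalues.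
Variables (R : rcfType) (theta : 'I_5 -> R) (g : R).

Definition s1 : {poly R} :=
  'X^2 - (theta 2 + theta 3 - g) *: 'X + (theta 2 * theta 3)%:P.

Definition s2 : {poly R} :=
  'X^2 - (theta 2 + theta 3) *: 'X + (g - theta 2 * theta 3)%:P.

End FiveEigenvalues.

(* Main.v *)
(* For a polynomial s of degree 2, the matrix M = s(A) - tau I is supported on
   the pairs of vertices at distance at most 2, whose indicator matrix is
   B = I + A + A_2.  The sum of the entries of M is n (s(k) - tau) and the sum of
   their squares is tr M^2 = sum_i m_i (s(theta_i) - tau)^2, so Cauchy-Schwarz
   for M and B is the bound, with equality iff M is a multiple of B.  For any tau
   this forces A_2 = q(A) with q of degree 2, i.e. 2-partial distance-regularity,
   and fixes the linear coefficient of q in terms of that of s; conversely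
   M = c B makes tau the optimal value.  Finally q(A) + eps A, a graph with
   adjacency matrix quadratic in A, is strongly regular iff the quadratic takes
   at most two values on theta_1, ..., theta_4, i.e. iff its axis of symmetry is
   (theta_2 + theta_3) / 2. *)
Require Import Defs.
From mathcomp Require Import all_boot all_order all_algebra.
From mathcomp Require Import ring lra.
Set Implicit Arguments.
Unset Strict Implicit.
Unset Printing Implicit Defensive.
Import Order.TTheory GRing.Theory Num.Theory.
Local Open Scope ring_scope.

(** * Polynomials evaluated at a square matrix *)

Lemma quadraticE (R : nzRingType) (p : {poly R}) : (size p <= 3)%N ->
  p = p`_2 *: 'X^2 + p`_1 *: 'X^1 + p`_0 *: 'X^0.
Proof.
move=> sp; apply/polyP => i; rewrite !coefD !coefZ !coefXn.
case: i => [|[|[|i]]] /=; rewrite ?(mulr0, mulr1, addr0, add0r) //.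
by rewrite nth_default // (leq_trans sp).
Qed.

Section PolyMx.
Variable R : comNzRingType.
Implicit Types p q : {poly R}.

Lemma poly_mxE n (A : 'M[R]_n.+1) p : poly_mx p A = horner_mx A p.
Proof.
rewrite -{2}(coefK p) poly_def linear_sum; apply: eq_bigr => i _ /=.
by rewrite linearZ rmorphXn /= horner_mx_X.
Qed.

Lemma poly_mxD n (A : 'M[R]_n) p q :
  poly_mx (p + q) A = poly_mx p A + poly_mx q A.
Proof. by case: n A => [|n] A; [rewrite !thinmx0 | rewrite !poly_mxE rmorphD]. Qed.

Lemma poly_mxB n (A : 'M[R]_n) p q :
  poly_mx (p - q) A = poly_mx p A - poly_mx q A.
Proof. by case: n A => [|n] A; [rewrite !thinmx0 | rewrite !poly_mxE rmorphB]. Qed.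

Lemma poly_mxZ n (A : 'M[R]_n) a p : poly_mx (a *: p) A = a *: poly_mx p A.
Proof. by case: n A => [|n] A; [rewrite !thinmx0 | rewrite !poly_mxE linearZ]. Qed.

Lemma poly_mxM n (A : 'M[R]_n) p q :
  poly_mx (p * q) A = poly_mx p A *m poly_mx q A.
Proof. by case: n A => [|n] A; [rewrite !thinmx0 | rewrite !poly_mxE rmorphM]. Qed.

Lemma poly_mxC n (A : 'M[R]_n) a : poly_mx a%:P A = a%:M.
Proof.
by case: n A => [|n] A; [rewrite !thinmx0 | rewrite poly_mxE horner_mx_C].
Qed.

Lemma poly_mx1 n (A : 'M[R]_n) : poly_mx 1 A = 1%:M.
Proof. by rewrite -polyC1 poly_mxC. Qed.

Lemma poly_mxX n (A : 'M[R]_n) : poly_mx 'X A = A.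
Proof.
by case: n A => [|n] A; [rewrite !thinmx0 | rewrite poly_mxE horner_mx_X].
Qed.

Lemma trmx_poly_mx n (A : 'M[R]_n) p : A^T = A -> (poly_mx p A)^T = poly_mx p A.
Proof.
move=> AT; elim/poly_ind: p => [|p c IH].
  by rewrite -polyC0 poly_mxC tr_scalar_mx.
rewrite poly_mxD poly_mxC linearD /= tr_scalar_mx mulrC poly_mxM poly_mxX.
(* The factor [A] is read as [poly_mx 'X A], so that it commutes with [poly_mx p A] because
   polynomials commute. *)
by rewrite trmx_mul IH AT -[X in _ *m X]poly_mxX -poly_mxM mulrC poly_mxM poly_mxX.
Qed.

Lemma poly_mx_eigenvector n (A : 'M[R]_n) (v : 'cV_n) a p :
  A *m v = a *: v -> poly_mx p A *m v = p.[a] *: v.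
Proof.
move=> Av; elim/poly_ind: p => [|p c IH].
  by rewrite -polyC0 poly_mxC hornerC mul_scalar_mx.
rewrite poly_mxD poly_mxC mulmxDl poly_mxM poly_mxX -mulmxA Av -scalemxAr IH.
by rewrite mul_scalar_mx !hornerE scalerDl scalerA mulrC.
Qed.

End PolyMx.

(** * Conjugation, traces and sums of squares of matrix entries *)

Lemma char_poly_conj (F : fieldType) n (P A : 'M[F]_n) :
  P \in unitmx -> char_poly (invmx P *m A *m P) = char_poly A.
Proof.
move=> Pu; rewrite /char_poly /char_poly_mx.
have PuX : map_mx (polyC : F -> _) (invmx P) *m map_mx polyC P = 1%:M.
  by rewrite -map_mxM mulVmx // map_mx1.
have -> : 'X%:M - map_mx polyC (invmx P *m A *m P) =
    map_mx polyC (invmx P) *m ('X%:M - map_mx polyC A) *m map_mx polyC P.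
  rewrite mulmxBr mulmxBl scalar_mxC -(mulmxA 'X%:M) PuX mulmx1.
  by rewrite !map_mxM.
by rewrite !det_mulmx mulrAC -det_mulmx PuX det1 mul1r.
Qed.

Lemma sqr_sum_mxtrace (R : comNzRingType) n (A : 'M[R]_n) :
  \sum_i \sum_j A i j ^+ 2 = \tr (A *m A^T).
Proof.
by apply: eq_bigr => i _; rewrite mxE; apply: eq_bigr => j _; rewrite mxE expr2.
Qed.

Lemma mxtrace_mul_sym (R : comNzRingType) n (A B : 'M[R]_n) : B^T = B ->
  \tr (A *m B) = \sum_i \sum_j A i j * B i j.
Proof.
move=> BT; apply: eq_bigr => i _; rewrite mxE; apply: eq_bigr => j _.
by rewrite -{1}BT mxE.
Qed.

Lemma sum_sqr_mx_eq0 (R : realDomainType) n (A : 'M[R]_n) :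
  \sum_i \sum_j A i j ^+ 2 = 0 -> A = 0.
Proof.
move=> /eqP; rewrite psumr_eq0 => [/allP A0|i _]; last first.
  by apply: sumr_ge0 => j _; rewrite sqr_ge0.
apply/matrixP => i j; rewrite mxE; apply/eqP.
have := A0 i (mem_index_enum i); rewrite psumr_eq0 => [/allP|j' _].
  by move/(_ j (mem_index_enum j)); rewrite sqrf_eq0.
exact: sqr_ge0.
Qed.

(** For a symmetric matrix, the trace of its square is the sum of the squares of its entries. *)
Lemma sym_mx_sqr_eq0 (R : realDomainType) n (A : 'M[R]_n) :
  A^T = A -> A *m A = 0 -> A = 0.
Proof.
move=> AT AA; apply: sum_sqr_mx_eq0.
by rewrite sqr_sum_mxtrace AT AA mxtrace0.
Qed.

Lemma distinct_roots_eq0 (F : idomainType) d (theta : 'I_d -> F) (p : {poly F}) :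
  injective theta -> (size p <= d)%N -> (forall i, p.[theta i] = 0) -> p = 0.
Proof.
move=> th_inj sp p0; apply: (@roots_geq_poly_eq0 _ _ [seq theta i | i <- enum 'I_d]).
- by apply/allP => _ /mapP[i _ ->]; apply/rootP/p0.
- by rewrite map_inj_uniq ?enum_uniq.
- by rewrite size_map size_enum_ord.
Qed.

Lemma decreasing_inj disp (T : porderType disp) d (theta : 'I_d -> T) :
  {homo theta : i j / (i < j)%N >-> (j < i)%O} -> injective theta.
Proof.
move=> th i j ij; apply/val_inj.
by case: (ltngtP i j) => // /th; rewrite ij ltxx.
Qed.

(** * Symmetric matrices with a given spectrum *)

Section Spectrum.
Variables (R : rcfType) (d n : nat) (theta : 'I_d.+1 -> R) (m : 'I_d.+1 -> nat).
Variable A : 'M[R]_n.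
Hypotheses (A_sym : A^T = A) (spec : has_spectrum theta m A).
Implicit Types p q : {poly R}.

Lemma spectrum_inj : injective theta.
Proof.
by have [th _ _] := spec; apply: decreasing_inj th.
Qed.

Lemma spectrum_size : n = (\sum_i m i)%N.
Proof.
have [_ _ chA] := spec; apply: succn_inj; rewrite -(size_char_poly A) chA.
rewrite size_prod; last by move=> i _; rewrite expf_neq0 // polyXsubC_eq0.
under eq_bigr => i _ do rewrite size_exp_XsubC -addn1.
by rewrite big_split /= sum1_card -addSn addnK.
Qed.

(* A power of this matrix vanishes by Cayley-Hamilton, and a nilpotent symmetric
   matrix is zero. *)
Lemma poly_mx_roots_eq0 : poly_mx (\prod_i ('X - (theta i)%:P)) A = 0.
Proof.
set q := \prod_i _.
have nilp l : poly_mx (q ^+ (2 ^ l)) A = 0 -> poly_mx q A = 0.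
  elim: l => [|l IH]; first by rewrite expr1.
  rewrite expnS mulnC exprM expr2 poly_mxM => qq0.
  by apply: IH; apply: sym_mx_sqr_eq0 qq0; apply: trmx_poly_mx.
apply: (nilp n).
(* The exponent is a power of two for the sake of repeated halving, and it exceeds [n], which bounds
   every multiplicity. *)
have /dvdpP[r ->] : char_poly A %| q ^+ (2 ^ n).
  have [_ _ ->] := spec; rewrite -prodrXl; apply: (big_ind2 (fun p r => p %| r)) => //.
    by move=> ? ? ? ?; apply: dvdp_mul.
  move=> i _; apply: dvdp_exp2l; apply: (@leq_trans n); last exact/ltnW/ltn_expl.
  by rewrite {1}spectrum_size (bigD1 i) //= leq_addr.
rewrite poly_mxM; case: (n) (A) => [|n'] A'; first by rewrite thinmx0.
by rewrite [X in _ *m X]poly_mxE Cayley_Hamilton mulmx0.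
Qed.

(** By [poly_mx_roots_eq0] the minimal polynomial has simple roots, so the matrix is diagonalizable;
    comparing characteristic polynomials shows that the diagonal lists each [theta i] exactly [m i]
    times. *)
Lemma mxtrace_poly_mx p : \tr (poly_mx p A) = \sum_i (m i)%:R * p.[theta i].
Proof.
have [_ mgt0 chA] := spec; move: chA poly_mx_roots_eq0.
have: (0 < n)%N by rewrite spectrum_size (bigD1 ord0) //= ltn_addr.
case: n A => [|n'] // A' _ chA qA.
have /diagonalizableP [P Pu /(similar_diagLR Pu)[D AD]] :
    exists2 rs, uniq rs & mxminpoly A' %| \prod_(x <- rs) ('X - x%:P).
  exists [seq theta i | i <- index_enum 'I_d.+1].
    by rewrite map_inj_uniq ?index_enum_uniq //; apply: spectrum_inj.
  by rewrite big_map; apply: mxminpoly_min; rewrite -poly_mxE.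
rewrite conjVmx // in AD.
have D_theta : perm_eq [seq D 0 i | i <- index_enum 'I_n'.+1]
    (flatten [seq nseq (m i) (theta i) | i <- index_enum 'I_d.+1]).
  apply: prod_XsubC_eq; rewrite big_map big_flatten big_map.
  under [RHS]eq_bigr => i _ do rewrite big_nseq -Monoid.iteropE /=.
  rewrite -chA AD char_poly_conj // char_poly_trig ?diag_mx_is_trig //.
  by apply: eq_bigr => i _; rewrite mxE eqxx.
rewrite poly_mxE AD horner_mx_uconjC ?unitmxE // mxtrace_mulC mulmxA mulmxV //.
rewrite mul1mx horner_mx_diag mxtrace_diag.
under eq_bigr => i _ do rewrite mxE.
rewrite -(big_map (fun i => D 0 i) xpredT (fun x => p.[x])).
rewrite (perm_big _ D_theta) /= big_flatten big_map; apply: eq_bigr => i _.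
by rewrite big_nseq -Monoid.iteropE /= mulr_natl.
Qed.

Lemma sum_sqr_poly_mx p :
  \sum_i \sum_j poly_mx p A i j ^+ 2 = \sum_i (m i)%:R * p.[theta i] ^+ 2.
Proof.
rewrite sqr_sum_mxtrace trmx_poly_mx // -poly_mxM mxtrace_poly_mx.
by apply: eq_bigr => i _; rewrite hornerM expr2.
Qed.

(** The squares of the entries of [poly_mx p A] add up to the squares of the values of [p] on the
    spectrum, taken with the positive weights [m i]. *)
Lemma poly_mx_eq0P p : poly_mx p A = 0 <-> forall i, p.[theta i] = 0.
Proof.
have [_ mgt0 _] := spec; split=> [p0 i|p0]; last first.
  apply: sum_sqr_mx_eq0; rewrite sum_sqr_poly_mx big1 // => i _.
  by rewrite p0 expr0n mulr0.
have /eqP : \sum_i (m i)%:R * p.[theta i] ^+ 2 = 0.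
  rewrite -sum_sqr_poly_mx p0 big1 // => j _; rewrite big1 // => l _.
  by rewrite mxE expr0n.
rewrite psumr_eq0 => [/allP/(_ i (mem_index_enum i))|j _]; last first.
  by rewrite mulr_ge0 ?ler0n ?sqr_ge0.
by rewrite mulf_eq0 pnatr_eq0 sqrf_eq0 eqn0Ngt mgt0 => /eqP.
Qed.

(** A polynomial of degree at most [d] that vanishes at the [d.+1] distinct eigenvalues is zero. *)
Lemma poly_mx_inj p q : (size p <= d.+1)%N -> (size q <= d.+1)%N ->
  poly_mx p A = poly_mx q A -> p = q.
Proof.
move=> sp sq pq; apply/eqP; rewrite -subr_eq0; apply/eqP.
have /poly_mx_eq0P pq0 : poly_mx (p - q) A = 0 by rewrite poly_mxB pq subrr.
apply: (distinct_roots_eq0 spectrum_inj); last exact: pq0.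
by rewrite (leq_trans (size_polyD _ _)) // size_polyN geq_max sp.
Qed.

(** In this form, orthogonality of polynomials can be read off from the supports of the matrices
    they produce. *)
Lemma spec_dotE p q :
  spec_dot theta m n p q = n%:R^-1 * \sum_i \sum_j poly_mx p A i j * poly_mx q A i j.
Proof.
rewrite -mxtrace_mul_sym ?trmx_poly_mx // -poly_mxM mxtrace_poly_mx.
by congr (_ * _); apply: eq_bigr => i _; rewrite hornerM mulrA.
Qed.

End Spectrum.

(** * Sums over vertices and the Cauchy-Schwarz defect *)

Lemma natr_card_set (R : pzSemiRingType) (T : finType) (P : pred T) :
  #|[set x | P x]|%:R = \sum_x (P x)%:R :> R.
Proof.
rewrite -natr_sum; congr (_%:R); rewrite -sum1_card big_mkcond /=.
by apply: eq_bigr => x _; rewrite inE; case: (P x).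
Qed.

Lemma sum_enum_val (R : nmodType) (T : finType) (F : T -> R) :
  \sum_(i < #|T|) F (enum_val i) = \sum_x F x.
Proof.
rewrite [RHS](reindex (fun i : 'I_#|T| => enum_val i)) //=.
by exists enum_rank => x _; rewrite ?enum_valK ?enum_rankK.
Qed.

(** As [B] is a 0/1 matrix that contains the support of [M], the entrywise inner products of [M]
    with [B] and of [B] with itself are [S] and [N]. Hence [S / N *: B] is the orthogonal projection
    of [M] on [B], and this is Pythagoras for the remainder. *)
Lemma sum_sqr_sub_scaled (F : numFieldType) n (M B : 'M[F]_n) :
  let S := \sum_i \sum_j M i j in let N := \sum_i \sum_j B i j in
  (forall i j, M i j * B i j = M i j) -> (forall i j, B i j ^+ 2 = B i j) ->
  N != 0 ->
  \sum_i \sum_j (M - S / N *: B) i j ^+ 2 =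
  \sum_i \sum_j M i j ^+ 2 - S ^+ 2 / N.
Proof.
move=> S N MB BB N0; set c := S / N.
have -> : S ^+ 2 / N = c * S *+ 2 - c ^+ 2 * N by rewrite /c; field.
rewrite /S /N !mulr_sumr -sumrMnl -sumrB -sumrB; apply: eq_bigr => i _.
rewrite !mulr_sumr -sumrMnl -sumrB -sumrB; apply: eq_bigr => j _.
rewrite !mxE sqrrB exprMn BB -{4}(MB i j); ring.
Qed.

(** * Vertices at distance at most two *)

Section GraphDistance.
Variables (V : finType) (e : rel V).
Hypotheses (e_irr : irreflexive e) (V_gt2 : (2 < #|V|)%N).

(** With more than two vertices, the search defining [gdist] tries the lengths 0, 1 and 2; if all
    three fail, its value is at least 3, the junk value included. *)
Lemma gdist_le2_cases u v :
  [/\ (gdist e u v == 0%N) = (u == v),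
      (gdist e u v == 1%N) = e u v,
      (gdist e u v == 2%N) =
        [&& u != v, ~~ e u v & [exists w, e u w && e w v]]
    & (gdist e u v <= 2)%N =
        [|| u == v, e u v | [exists w, e u w && e w v]]].
Proof.
have walk0 : [exists p : 0.-tuple V, path e u p && (last u p == v)] = (u == v).
  by apply/existsP/idP => [[p]|uv]; [rewrite tuple0 | exists [tuple]].
have walk1 : [exists p : 1.-tuple V, path e u p && (last u p == v)] = e u v.
  apply/existsP/idP => [[p]|uv]; last by exists [tuple v]; rewrite /= uv eqxx.
  by case/tupleP: p => w p; rewrite tuple0 /= andbT => /andP[uw /eqP <-].
have walk2 : [exists p : 2.-tuple V, path e u p && (last u p == v)] =
    [exists w, e u w && e w v].
  apply/existsP/existsP => [[p]|[w /andP[uw wv]]]; last first.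
    by exists [tuple w; v]; rewrite /= uw wv eqxx.
  case/tupleP: p => w p; case/tupleP: p => w' p; rewrite tuple0 /= andbT.
  by move=> /andP[/andP[uw ww'] /eqP <-]; exists w; rewrite uw.
rewrite /gdist; case: #|V| V_gt2 => [|[|[|N]]] //= _; rewrite walk0 walk1 walk2.
have [<-|] := eqVneq u v; first by rewrite e_irr.
by case: (e u v) => //; case: [exists w, _].
Qed.

Lemma gdist0 u v : (gdist e u v == 0%N) = (u == v).
Proof. by case: (gdist_le2_cases u v). Qed.

Lemma gdist1 u v : (gdist e u v == 1%N) = e u v.
Proof. by case: (gdist_le2_cases u v). Qed.

Lemma gdist_le2 u v :
  (gdist e u v <= 2)%N = [|| u == v, e u v | [exists w, e u w && e w v]].
Proof. by case: (gdist_le2_cases u v). Qed.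

Lemma gdist_diag u : gdist e u u = 0%N.
Proof. by apply/eqP; rewrite gdist0. Qed.

End GraphDistance.

(** * The adjacency matrix of a connected regular graph *)

Section RegularGraph.
Variables (R : rcfType) (V : finType) (e : rel V) (k : nat).
Hypotheses (e_sym : symmetric e) (e_irr : irreflexive e).
Hypotheses (e_conn : connected_graph e) (e_reg : regular_graph e k).

Local Notation A := (adj_mx e R).
Local Notation n := #|V|.

Lemma trmx_adj_mx : A^T = A.
Proof. by apply/matrixP => i j; rewrite !mxE e_sym. Qed.

Lemma adj_mx_ones : A *m const_mx 1 = k%:R *: const_mx 1 :> 'cV_n.
Proof.
apply/matrixP => i j; rewrite !mxE mulr1 -(e_reg (enum_val i)) natr_card_set.
rewrite -[RHS]sum_enum_val; apply: eq_bigr => l _.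
by rewrite !mxE mulr1.
Qed.

Lemma poly_mx_row_sum (p : {poly R}) i : \sum_j poly_mx p A i j = p.[k%:R].
Proof.
have /matrixP/(_ i 0) := poly_mx_eigenvector p adj_mx_ones.
rewrite !mxE mulr1 => <-; apply: eq_bigr => j _; by rewrite mxE mulr1.
Qed.

Lemma poly_mx_total (p : {poly R}) :
  \sum_i \sum_j poly_mx p A i j = n%:R * p.[k%:R].
Proof.
under eq_bigr => i _ do rewrite poly_mx_row_sum.
by rewrite sumr_const card_ord mulr_natl.
Qed.

(* The Dirichlet form of a [k]-eigenfunction vanishes. *)
Lemma eigenfunction_const (f : V -> R) :
  (forall u, \sum_w (e u w)%:R * f w = k%:R * f u) -> forall u v, f u = f v.
Proof.
move=> fk.
have deg u : \sum_w (e u w)%:R = k%:R :> R.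
  by rewrite -(e_reg u) natr_card_set.
have /eqP : \sum_u \sum_w (e u w)%:R * (f u - f w) ^+ 2 = 0.
  have E1 : \sum_u \sum_w (e u w)%:R * f u ^+ 2 = k%:R * \sum_u f u ^+ 2.
    by rewrite mulr_sumr; apply: eq_bigr => u _; rewrite -mulr_suml deg.
  have E2 : \sum_u \sum_w (e u w)%:R * f w ^+ 2 = k%:R * \sum_u f u ^+ 2.
    rewrite exchange_big -E1; apply: eq_bigr => u _; apply: eq_bigr => w _.
    by rewrite e_sym.
  have E3 : \sum_u \sum_w (e u w)%:R * (f u * f w) = k%:R * \sum_u f u ^+ 2.
    rewrite mulr_sumr; apply: eq_bigr => u _.
    rewrite expr2 mulrA -fk mulr_suml; apply: eq_bigr => w _; ring.
  transitivity (\sum_u \sum_w (e u w)%:R * f u ^+ 2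
    - (\sum_u \sum_w (e u w)%:R * (f u * f w)) *+ 2
    + \sum_u \sum_w (e u w)%:R * f w ^+ 2).
    rewrite -sumrMnl -sumrB -big_split; apply: eq_bigr => u _ /=.
    rewrite -sumrMnl -sumrB -big_split; apply: eq_bigr => w _ /=; ring.
  rewrite E1 E2 E3; ring.
rewrite psumr_eq0 => [/allP f0|u _]; last first.
  by apply: sumr_ge0 => w _; rewrite mulr_ge0 ?ler0n ?sqr_ge0.
have step u w : e u w -> f u = f w.
  have := f0 u (mem_index_enum u); rewrite psumr_eq0 => [/allP|w' _]; last first.
    by rewrite mulr_ge0 ?ler0n ?sqr_ge0.
  move=> /(_ w (mem_index_enum w)) + uw.
  by rewrite uw mul1r sqrf_eq0 subr_eq0 => /eqP.
move=> u v; case/connectP: (e_conn u v) => p + ->.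
elim: p u => [|w p IH] u //= /andP[/step -> ]; exact: IH.
Qed.

(** Each column is a [k]-eigenfunction, hence constant; by symmetry so is each row. *)
Lemma eigenmatrix_const (Q : 'M[R]_n) :
  Q^T = Q -> A *m Q = k%:R *: Q -> exists c, Q = const_mx c.
Proof.
move=> QT AQ.
have colc i i' j : Q i j = Q i' j.
  rewrite -(enum_valK i) -(enum_valK i').
  apply: (eigenfunction_const (f := fun u => Q (enum_rank u) j)) => u.
  have /matrixP/(_ (enum_rank u) j) := AQ; rewrite !mxE => <-.
  rewrite -[LHS]sum_enum_val; apply: eq_bigr => l _.
  by rewrite !mxE enum_valK enum_rankK.
have rowc i j j' : Q i j = Q i j' by rewrite -QT !mxE; apply: colc.
case: (posnP n) => [V0|V_gt0].
  by exists 0; apply/matrixP => i; have := ltn_ord i; rewrite {2}V0.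
pose i0 := Ordinal V_gt0; exists (Q i0 i0); apply/matrixP => i j.
by rewrite mxE (colc i i0) (rowc i0 j i0).
Qed.

Section Distance.
Hypothesis V_gt2 : (2 < n)%N.

Lemma dist_mx0 : dist_mx e R 0 = 1%:M.
Proof.
apply/matrixP => i j; rewrite !mxE gdist0 //; congr (_%:R).
by rewrite (inj_eq enum_val_inj).
Qed.

Lemma dist_mx1 : dist_mx e R 1 = A.
Proof. by apply/matrixP => i j; rewrite !mxE gdist1. Qed.

Definition ball2_mx : 'M[R]_n :=
  \matrix_(i, j) (gdist e (enum_val i) (enum_val j) <= 2)%N%:R.

Lemma ball2_mxE : ball2_mx = 1%:M + A + dist_mx e R 2.
Proof.
rewrite -dist_mx0 -dist_mx1; apply/matrixP => i j; rewrite !mxE.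
by case: (gdist _ _ _) => [|[|[|l]]]; rewrite /= ?(add0r, addr0).
Qed.

Lemma ball2_mx_idem i j : ball2_mx i j ^+ 2 = ball2_mx i j.
Proof. by rewrite mxE; case: (_ <= 2)%N; rewrite ?expr1n ?expr0n. Qed.

Lemma ball2_mx_total : \sum_i \sum_j ball2_mx i j = n%:R * avg_ball2_size e R.
Proof.
rewrite /avg_ball2_size mulrC divfK ?pnatr_eq0 -?lt0n; last exact: ltn_trans V_gt2.
rewrite -[RHS]sum_enum_val; apply: eq_bigr => i _.
by rewrite natr_card_set -[RHS]sum_enum_val; apply: eq_bigr => j _; rewrite mxE.
Qed.

Lemma poly_mx_quadratic (p : {poly R}) : (size p <= 3)%N ->
  poly_mx p A = p`_2 *: (A *m A) + p`_1 *: A + p`_0 *: 1%:M.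
Proof.
move=> sp; rewrite [in LHS](quadraticE sp) expr1 expr0 expr2.
by rewrite !poly_mxD !poly_mxZ poly_mxM poly_mxX poly_mx1.
Qed.

(** The matrix is a combination of the identity, [A] and [A *m A], and an entry of any of these can
    be nonzero only at a pair joined by a walk of length 0, 1 or 2. *)
Lemma poly_mx_supp (p : {poly R}) i j : (size p <= 3)%N ->
  poly_mx p A i j * ball2_mx i j = poly_mx p A i j.
Proof.
move=> sp; rewrite [ball2_mx i j]mxE gdist_le2 //.
case: eqVneq => [|uv] /=; first by rewrite mulr1.
case euv : (e _ _) => /=; first by rewrite mulr1.
case: existsP => [_|euwv]; rewrite ?mulr1 // mulr0 poly_mx_quadratic //.
rewrite !mxE euv -(inj_eq enum_val_inj) (negPf uv) !mulr0 !addr0.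
rewrite big1 ?mulr0 // => l _; rewrite !mxE.
case euw : (e _ _); rewrite ?mul0r // mul1r; case ewv: (e _ _) => //.
by case: euwv; exists (enum_val l); rewrite euw.
Qed.

End Distance.
End RegularGraph.

(** * The spectral inner product *)

Section SpecDot.
Variables (R : rcfType) (d n : nat) (theta : 'I_d.+1 -> R) (m : 'I_d.+1 -> nat).
Local Notation dot := (spec_dot theta m n).
Implicit Types p q r : {poly R}.

Lemma spec_dotC p q : dot p q = dot q p.
Proof. by congr (_ * _); apply: eq_bigr => i _; rewrite mulrAC. Qed.

Lemma spec_dotDr r p q : dot r (p + q) = dot r p + dot r q.
Proof.
rewrite -mulrDr -big_split; congr (_ * _); apply: eq_bigr => i _ /=.
by rewrite hornerD mulrDr.
Qed.

Lemma spec_dotZr r a p : dot r (a *: p) = a * dot r p.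
Proof.
rewrite mulrCA [a * _]mulr_sumr; congr (_ * _); apply: eq_bigr => i _.
by rewrite hornerZ mulrCA.
Qed.

Lemma spec_dot_sumr r (I : finType) (P : pred I) (F : I -> {poly R}) :
  dot r (\sum_(i | P i) F i) = \sum_(i | P i) dot r (F i).
Proof.
elim/big_rec2: _ => [|i y1 y2 _ <-]; last by rewrite spec_dotDr.
by rewrite -(scale0r 0) spec_dotZr mul0r.
Qed.

Lemma spec_dotXn l l' : dot 'X^l 'X^l' = avg_closed_walks theta m n (l + l').
Proof.
congr (_ * _); apply: eq_bigr => i _.
by rewrite !hornerXn -mulrA exprD.
Qed.

(** A family with one polynomial of each degree below [l] spans all polynomials of degree below [l];
    the induction subtracts the multiple of [f l] that cancels the top coefficient. *)
Lemma spec_dot_span (f : nat -> {poly R}) r l p :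
  (forall i, (i < l)%N -> size (f i) = i.+1) ->
  (forall i, (i < l)%N -> dot r (f i) = 0) ->
  (size p <= l)%N -> dot r p = 0.
Proof.
elim: l p => [|l IH] p szf rf szp.
  by move: szp; rewrite leqn0 size_poly_eq0 => /eqP->;
     rewrite -(scale0r 0) spec_dotZr mul0r.
have szfl := szf l (ltnSn l).
have lc0 : lead_coef (f l) != 0 by rewrite lead_coef_eq0 -size_poly_gt0 szfl.
pose a := p`_l / lead_coef (f l).
rewrite -(subrK (a *: f l) p) spec_dotDr spec_dotZr rf // mulr0 addr0.
apply: IH => [i /ltnW|i /ltnW|]; [exact: szf | exact: rf |].
apply/leq_sizeP => i; rewrite leq_eqVlt => /orP[/eqP <-|li].
  rewrite coefB coefZ /a; move: lc0; rewrite /lead_coef szfl /= => lc0.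
  by rewrite divfK // subrr.
rewrite coefB coefZ !nth_default ?mulr0 ?subrr ?szfl //.
exact: leq_trans li.
Qed.

End SpecDot.

(** * Construction of the predistance polynomials *)

Section Predistance.
Variables (R : rcfType) (d n k : nat) (theta : 'I_d.+1 -> R) (m : 'I_d.+1 -> nat).
Hypotheses (th_decr : {homo theta : i j / (i < j)%N >-> j < i}).
Hypotheses (m_gt0 : forall i, (0 < m i)%N) (n_gt0 : (0 < n)%N).
Hypothesis theta0 : theta ord0 = k%:R.
Local Notation dot := (spec_dot theta m n).
Implicit Types p q r : {poly R}.

(** The form is definite in degree at most [d]: a polynomial of norm zero vanishes at [d.+1]
    distinct points. *)
Lemma spec_dot_neq0 p : p != 0 -> (size p <= d.+1)%N -> dot p p != 0.
Proof.
move=> p0 sp; apply: contra p0; rewrite mulf_eq0 invr_eq0 pnatr_eq0.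
rewrite eqn0Ngt n_gt0 /= psumr_eq0 => [/allP pp|i _]; last first.
  by rewrite -mulrA mulr_ge0 ?ler0n // -expr2 sqr_ge0.
apply/eqP/(distinct_roots_eq0 (decreasing_inj th_decr)) => // i.
have := pp i (mem_index_enum i).
by rewrite -mulrA mulf_eq0 pnatr_eq0 eqn0Ngt m_gt0 /= -expr2 sqrf_eq0 => /eqP.
Qed.

(* If [r = ('X - k) w] then [dot r w] is a sum of nonpositive terms, as [k] is
   the largest eigenvalue. *)
Lemma orthogonal_horner_neq0 r l : (l <= d)%N -> size r = l.+1 ->
  (forall p, (size p <= l)%N -> dot r p = 0) -> r.[k%:R] != 0.
Proof.
move=> ld szr r_orth; apply/negP => /factor_theorem [w rw].
have r0 : r != 0 by rewrite -size_poly_gt0 szr.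
have w0 : w != 0 by apply: contraNneq r0 => w0; rewrite rw w0 mul0r.
have szw : size w = l.
  have := szr; rewrite rw size_Mmonic ?monicXsubC // size_XsubC addn2 /=.
  by case.
case/eqP: r0; apply: (distinct_roots_eq0 (decreasing_inj th_decr)); first by rewrite szr.
have := r_orth w; rewrite szw => /(_ (leqnn l)) /eqP.
rewrite mulf_eq0 invr_eq0 pnatr_eq0 eqn0Ngt n_gt0 /= -oppr_eq0 -sumrN.
have th_le i : theta i <= k%:R.
  rewrite -theta0; case: (posnP i) => [i0|i0]; last by apply/ltW/th_decr.
  by rewrite (_ : i = ord0) //; apply/val_inj.
have termE i : - ((m i)%:R * r.[theta i] * w.[theta i]) =
    (m i)%:R * (k%:R - theta i) * w.[theta i] ^+ 2.
  by rewrite rw hornerM hornerXsubC; ring.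
rewrite psumr_eq0 => [/allP rw0 i|i _]; last first.
  by rewrite termE mulr_ge0 ?sqr_ge0 // mulr_ge0 ?ler0n ?subr_ge0.
have := rw0 i (mem_index_enum i); rewrite termE !mulf_eq0 pnatr_eq0 eqn0Ngt.
rewrite m_gt0 rw hornerM hornerXsubC /= subr_eq0 orbb => /orP[/eqP <-|/eqP ->].
  by rewrite subrr mulr0.
by rewrite mul0r.
Qed.

(** An initial segment of the predistance polynomials, indexed by [nat] so that it can be prolonged
    one degree at a time. *)
Definition predistance_upto l (f : nat -> {poly R}) : Prop :=
  [/\ forall i, (i < l)%N -> size (f i) = i.+1,
      forall i j, (i < l)%N -> (j < l)%N -> i != j -> dot (f i) (f j) = 0
    & forall i, (i < l)%N -> dot (f i) (f i) = (f i).[k%:R]].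

(** One Gram-Schmidt step applied to ['X^l], followed by a rescaling that is possible because the
    new polynomial is nonzero at [k]. *)
Lemma predistance_extend l f : (l <= d)%N -> predistance_upto l f ->
  exists r, predistance_upto l.+1 (fun i => if i == l then r else f i).
Proof.
move=> ld [szf orth norm].
have f0 i : (i < l)%N -> dot (f i) (f i) != 0.
  move=> il; apply: spec_dot_neq0; first by rewrite -size_poly_gt0 szf.
  by rewrite szf // ltnS (leq_trans (ltnW il)).
pose r0 := 'X^l - \sum_(i < l) (dot 'X^l (f i) / dot (f i) (f i)) *: f i.
have szr0 : size r0 = l.+1.
  rewrite size_polyDl size_polyXn // size_polyN ltnS.
  apply: (leq_trans (size_sum _ _ _)); apply/bigmax_leqP => i _.
  by rewrite (leq_trans (size_scale_leq _ _)) // szf.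
have r0_orth i : (i < l)%N -> dot r0 (f i) = 0.
  move=> il; rewrite spec_dotC /r0 -scaleN1r spec_dotDr spec_dotZr spec_dot_sumr.
  rewrite (bigD1 (Ordinal il)) //= big1 => [|j ji]; last first.
    by rewrite spec_dotZr [X in _ * X]orth ?mulr0 // eq_sym.
  by rewrite addr0 spec_dotZr divfK ?f0 // spec_dotC mulN1r subrr.
have r0k : r0.[k%:R] != 0.
  by apply: (orthogonal_horner_neq0 ld) => // p; apply: spec_dot_span szf r0_orth.
have r00 : dot r0 r0 != 0.
  by apply: spec_dot_neq0; rewrite -?size_poly_gt0 szr0 ?ltnS.
(* Scaling [r0] by this factor [c] turns its square norm into [c ^+ 2 * dot r0 r0 = c * r0.[k%:R]],
   which is the required normalization. *)
have c0 : r0.[k%:R] / dot r0 r0 != 0 by rewrite mulf_neq0 ?invr_eq0.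
exists ((r0.[k%:R] / dot r0 r0) *: r0); split=> [i|i j|i].
- rewrite ltnS leq_eqVlt; case: eqVneq => [->|_] /= il; last exact: szf.
  by rewrite size_scale.
- rewrite !ltnS (leq_eqVlt i) (leq_eqVlt j).
  have [->|il] := eqVneq i l; have [->|jl] := eqVneq j l => //=.
  + by move=> _ jl' _; rewrite spec_dotC spec_dotZr spec_dotC r0_orth ?mulr0.
  + by move=> il' _ _; rewrite spec_dotZr spec_dotC r0_orth ?mulr0.
  + exact: orth.
- rewrite ltnS leq_eqVlt; case: eqVneq => [->|_] /= il; last exact: norm.
  by rewrite spec_dotZr spec_dotC spec_dotZr hornerZ; field.
Qed.

(** Used to embed the polynomials [1], ['X] and the distance-2 polynomial in a full predistance
    family; the induction is on the number of degrees still missing. *)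
Lemma predistance_complete l f : (l <= d.+1)%N -> predistance_upto l f ->
  exists2 p : 'I_d.+1 -> {poly R}, predistance_polys theta m n k p
    & forall i : 'I_d.+1, (i < l)%N -> p i = f i.
Proof.
have [t] := ubnP (d.+1 - l); elim: t => // t IH in l f *; rewrite ltnS => dlt.
rewrite leq_eqVlt => /orP[/eqP ->|ld] pf.
  have [szf orth norm] := pf; exists (fun i => f i) => //.
  by split=> [i|i j ij|i]; [apply: szf | apply: orth | apply: norm].
have [r pr] := predistance_extend ld pf.
have [||p pp pf'] := IH _ _ _ _ pr => //.
  by apply: leq_trans dlt; rewrite subSS subSn.
exists p => // i il; rewrite pf' ?(ltn_eqF il) //; exact: ltnW.
Qed.

End Predistance.

(** * The spectral bound on the average size of a ball of radius two *)

Section SpectralGraph.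
Variables (R : rcfType) (V : finType) (e : rel V) (k d : nat).
Variables (theta : 'I_d.+1 -> R) (m : 'I_d.+1 -> nat).
Hypotheses (e_sym : symmetric e) (e_irr : irreflexive e).
Hypotheses (e_conn : connected_graph e) (e_reg : regular_graph e k).
Hypotheses (spec : has_spectrum theta m (adj_mx e R)).
Hypotheses (theta0 : theta ord0 = k%:R) (d_gt1 : (1 < d)%N).

Local Notation A := (adj_mx e R).
Local Notation A2 := (dist_mx e R 2).
Local Notation n := #|V|.
Local Notation dot := (spec_dot theta m n).
Local Notation avg := (avg_ball2_size e R).

(** There are at least three eigenvalues, each of positive multiplicity. *)
Lemma spectrum_card_gt2 : (2 < n)%N.
Proof.
have [_ m_gt0 _] := spec; apply: leq_ltn_trans d_gt1 _.
rewrite (spectrum_size spec) -[X in (X <= _)%N](card_ord d.+1) -sum1_card.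
by apply: leq_sum => i _.
Qed.
Local Notation n_gt2 := spectrum_card_gt2.

Let n_neq0 : n%:R != 0 :> R.
Proof. by rewrite pnatr_eq0 -lt0n (ltn_trans _ n_gt2). Qed.

Let AT := trmx_adj_mx R e_sym.

(** Degree zero would make [A] vanish, so that ['X] and [0] would agree at [A] despite their small
    degree. *)
Lemma degree_neq0 : k%:R != 0 :> R.
Proof.
apply/negP => /eqP k0; have A0 : A = 0.
  apply: sum_sqr_mx_eq0; transitivity (\sum_i \sum_j poly_mx 'X A i j).
    rewrite poly_mxX; apply: eq_bigr => i _.
    by apply: eq_bigr => j _; rewrite mxE; case: (e _ _); rewrite ?expr1n ?expr0n.
  by rewrite (poly_mx_total e_reg) hornerX k0 mulr0.
have /eqP : 'X = 0 :> {poly R}.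
  apply: (poly_mx_inj AT spec); rewrite ?size_polyX ?size_poly0 ?ltnS ?(ltnW d_gt1) //.
  by rewrite poly_mxX A0 -polyC0 poly_mxC raddf0.
by rewrite polyX_eq0.
Qed.

(** A ball contains its centre and [k > 0] neighbours. Strictness matters: [avg - 1] is a factor of
    the denominator of [tau_opt] in [tau_optE]. *)
Lemma avg_ball2_gt1 : 1 < avg.
Proof.
have kA : \sum_i \sum_j A i j = n%:R * k%:R.
  by rewrite -[in RHS](hornerX k%:R) -(poly_mx_total e_reg) poly_mxX.
have k_gt0 : 0 < k%:R :> R by rewrite lt_neqAle eq_sym degree_neq0 ler0n.
have n_gt0 : 0 < n%:R :> R by rewrite lt_neqAle eq_sym n_neq0 ler0n.
rewrite -(ltr_pM2l n_gt0) -(ball2_mx_total R e n_gt2) mulr1.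
apply: (@lt_le_trans _ _ (\sum_i \sum_j ((1%:M : 'M[R]_n) i j + A i j))).
  under eq_bigr => i _ do rewrite big_split.
  rewrite big_split /= kA -[X in X < _]addr0.
  apply: ler_ltD; last by rewrite mulr_gt0.
  have -> : n%:R = \sum_(i < n) 1 :> R by rewrite sumr_const card_ord.
  apply: ler_sum => i _.
  rewrite (bigD1 i) //= mxE eqxx lerDl; apply: sumr_ge0 => j _.
  by rewrite mxE ler0n.
apply: ler_sum => i _; apply: ler_sum => j _.
by rewrite (ball2_mxE R e_irr n_gt2) !mxE lerDl ler0n.
Qed.

Section Bound.
Variables (s : {poly R}) (t : R).
Hypothesis s_size : size s = 3%N.

Local Notation p := (s - t%:P).

Let p_size : size p = 3%N.
Proof.
rewrite size_polyDl // size_polyN s_size.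
exact: leq_ltn_trans (size_polyC_leq1 _) _.
Qed.

Let p_eval i : p.[theta i] = s.[theta i] - t.
Proof. by rewrite !hornerE. Qed.

Let dev : \sum_i (m i)%:R * (s.[theta i] - t) ^+ 2 =
  \sum_i \sum_j poly_mx p A i j ^+ 2.
Proof.
rewrite (sum_sqr_poly_mx AT spec); apply: eq_bigr => i _.
by rewrite p_eval.
Qed.

Lemma poly_mx_sub_neq0 : poly_mx p A != 0.
Proof.
apply/eqP => p0; have p00 : p = 0.
  apply: (poly_mx_inj AT spec); rewrite ?p_size ?size_poly0 //.
  by rewrite p0 -polyC0 poly_mxC raddf0.
by move: p_size; rewrite p00 size_poly0.
Qed.

Let dev_gt0 : 0 < \sum_i (m i)%:R * (s.[theta i] - t) ^+ 2.
Proof.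
rewrite lt_neqAle eq_sym dev; apply/andP; split; last first.
  by apply: sumr_ge0 => i _; apply: sumr_ge0 => j _; rewrite sqr_ge0.
by apply: contraNneq poly_mx_sub_neq0 => /sum_sqr_mx_eq0 ->.
Qed.

(** The defect in Cauchy-Schwarz is a positive multiple of the squared norm of the remainder of
    [poly_mx p A] after projection on [ball2_mx]. Both the bound and its equality case follow. *)
Let gap : avg - Phi theta m n s t =
  avg / (\sum_i (m i)%:R * (s.[theta i] - t) ^+ 2) *
  \sum_i \sum_j (poly_mx p A - (s.[k%:R] - t) / avg *: ball2_mx R e) i j ^+ 2.
Proof.
have avg0 : avg != 0 by apply: lt0r_neq0; apply: lt_trans avg_ball2_gt1.
have := @sum_sqr_sub_scaled _ _ (poly_mx p A) (ball2_mx R e); cbv zeta.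
rewrite (ball2_mx_total R e n_gt2) (poly_mx_total e_reg) -dev.
have -> : n%:R * p.[k%:R] / (n%:R * avg) = (s.[k%:R] - t) / avg.
  by rewrite -theta0 p_eval; field; rewrite avg0.
move=> ->.
- rewrite /Phi -theta0 p_eval; move: dev_gt0.
  set T := \sum_i _ => T0; field; rewrite avg0 n_neq0 ?lt0r_neq0 //.
- by move=> i j; apply: poly_mx_supp; rewrite ?p_size ?n_gt2.
- exact: ball2_mx_idem.
- by rewrite mulf_neq0.
Qed.

Let multiple_dev c : poly_mx p A = c *: ball2_mx R e ->
  s.[theta ord0] - t = c * avg.
Proof.
move=> pc; apply: (mulfI n_neq0).
rewrite -p_eval theta0 -(poly_mx_total e_reg) pc mulrCA.
rewrite -(ball2_mx_total R e n_gt2) mulr_sumr; apply: eq_bigr => i _.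
by rewrite mulr_sumr; apply: eq_bigr => j _; rewrite mxE.
Qed.

Lemma Phi_le_avg : Phi theta m n s t <= avg.
Proof.
rewrite -subr_ge0 gap; apply: mulr_ge0.
  rewrite divr_ge0 // ltW // ; exact: lt_trans avg_ball2_gt1.
by apply: sumr_ge0 => i _; apply: sumr_ge0 => j _; rewrite sqr_ge0.
Qed.

Lemma Phi_eq_avgP :
  avg = Phi theta m n s t <-> exists c, poly_mx p A = c *: ball2_mx R e.
Proof.
have avg_gt0 : 0 < avg by apply: lt_trans avg_ball2_gt1.
split=> [E|[c pc]].
  have /eqP := gap; rewrite -E subrr eq_sym mulf_eq0.
  rewrite (gt_eqF (divr_gt0 avg_gt0 dev_gt0)) /= => /eqP /sum_sqr_mx_eq0 /eqP.
  by rewrite subr_eq0 => /eqP ->; eexists.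
have -> : Phi theta m n s t = avg - (avg - Phi theta m n s t) by ring.
rewrite gap pc.
rewrite -theta0 (multiple_dev pc) mulfK ?gt_eqF //.
rewrite subrr [X in _ - _ * X]big1 ?mulr0 ?subr0 // => i _; rewrite big1 // => j _.
by rewrite mxE expr0n.
Qed.

(** The trace, the sum of squared entries and the sum of entries of the matrix equation express [U],
    [W] and [s.[theta ord0]] through [t], [c], [n] and [avg]; substituted in [tau_opt], they leave
    [t]. *)
Lemma tau_optE c : m ord0 = 1%N -> poly_mx p A = c *: ball2_mx R e ->
  tau_opt theta m n s = t.
Proof.
move=> m0 pc; have avg_gt1 := avg_ball2_gt1.
have c0 : c != 0.
  by apply: contraNneq poly_mx_sub_neq0 => c0; rewrite pc c0 scale0r.
have sumM : \sum_i (m i)%:R = n%:R :> R by rewrite -natr_sum -(spectrum_size spec).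
pose U := \sum_i (m i)%:R * s.[theta i].
pose W := \sum_i (m i)%:R * s.[theta i] ^+ 2.
have trp : U - t * n%:R = c * n%:R.
  transitivity (\tr (poly_mx p A)).
    rewrite (mxtrace_poly_mx AT spec) -sumM mulr_sumr -sumrB.
    by apply: eq_bigr => i _; rewrite p_eval; ring.
  rewrite pc mxtraceZ /mxtrace; congr (_ * _).
  under eq_bigr => i _ do rewrite mxE (gdist_diag e_irr n_gt2).
  by rewrite sumr_const card_ord.
have devW : W - 2 * t * U + t ^+ 2 * n%:R = c ^+ 2 * (n%:R * avg).
  transitivity (\sum_i (m i)%:R * (s.[theta i] - t) ^+ 2).
    rewrite -sumM !mulr_sumr -sumrB -big_split; apply: eq_bigr => i _ /=; ring.
  rewrite dev pc -(ball2_mx_total R e n_gt2) mulr_sumr; apply: eq_bigr => i _.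
  rewrite mulr_sumr; apply: eq_bigr => j _.
  by rewrite mxE exprMn ball2_mx_idem.
have s0 : s.[theta ord0] = t + c * avg by rewrite -(multiple_dev pc) subrKC.
have S1 : \sum_(i | i != ord0) (m i)%:R * s.[theta i] = U - s.[theta ord0].
  by rewrite /U [X in _ = X - _](bigD1 ord0) //= m0 mul1r addrAC subrr add0r.
have S2 : \sum_(i | i != ord0) (m i)%:R * s.[theta i] ^+ 2 = W - s.[theta ord0] ^+ 2.
  by rewrite /W [X in _ = X - _](bigD1 ord0) //= m0 mul1r addrAC subrr add0r.
rewrite /tau_opt S1 S2.
have -> : U = c * n%:R + t * n%:R by rewrite -trp subrK.
have -> : W = c ^+ 2 * (n%:R * avg) + 2 * t * (c * n%:R + t * n%:R) - t ^+ 2 * n%:R.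
  by rewrite -devW -trp; ring.
rewrite s0; field.
(* The denominator of [tau_opt], nonzero since [avg > 1]. *)
have -> : (t + c * avg) * (n%:R - 1) - (c * n%:R + t * n%:R - (t + c * avg)) =
   c * n%:R * (avg - 1) by ring.
by rewrite !mulf_neq0 // subr_eq0 gt_eqF.
Qed.

End Bound.
End SpectralGraph.

(** * Distance-2 polynomials and the preintersection number *)

Lemma size_quadratic (R : nzRingType) (b c : R) :
  size ('X^2 - b *: 'X + c%:P) = 3%N.
Proof.
rewrite -addrA size_polyDl size_polyXn // ltnS.
rewrite (leq_trans (size_polyD _ _)) // geq_max size_polyN.
rewrite (leq_trans (size_scale_leq _ _)) ?size_polyX //.
by rewrite (leq_trans (size_polyC_leq1 _)).
Qed.

Lemma horner_quadratic (R : comNzRingType) (p : {poly R}) x : (size p <= 3)%N ->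
  p.[x] = p`_2 * x ^+ 2 + p`_1 * x + p`_0.
Proof.
by move=> sp; rewrite [p in p.[x]]quadraticE // !hornerD !hornerZ !hornerXn expr0 mulr1.
Qed.

Section DistancePolynomial.
Variables (R : rcfType) (V : finType) (e : rel V) (k d : nat).
Variables (theta : 'I_d.+1 -> R) (m : 'I_d.+1 -> nat).
Hypotheses (e_sym : symmetric e) (e_irr : irreflexive e).
Hypotheses (e_conn : connected_graph e) (e_reg : regular_graph e k).
Hypotheses (spec : has_spectrum theta m (adj_mx e R)).
Hypotheses (theta0 : theta ord0 = k%:R) (d_gt1 : (1 < d)%N).

Local Notation A := (adj_mx e R).
Local Notation n := #|V|.
Local Notation dot := (spec_dot theta m n).

Let AT := trmx_adj_mx R e_sym.
Let n_gt2 := spectrum_card_gt2 spec d_gt1.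
Let k_neq0 := degree_neq0 e_sym e_reg spec d_gt1.

Let n_gt0 : (0 < n)%N. Proof. exact: ltn_trans n_gt2. Qed.

(** Distance matrices are 0/1 matrices with disjoint supports, so different ones are orthogonal and
    the square norm of each is its average row sum, the value at [k]. These are exactly the
    predistance conditions. *)
Lemma spec_dot_dist i j (p q : {poly R}) :
  poly_mx p A = dist_mx e R i -> poly_mx q A = dist_mx e R j ->
  dot p q = if i == j then p.[k%:R] else 0.
Proof.
move=> pi qj; rewrite (spec_dotE AT spec).
case: eqVneq => [ij|ij].
  have n0 : n%:R != 0 :> R by rewrite pnatr_eq0 -lt0n.
  rewrite -[RHS](mulKf n0) -(poly_mx_total e_reg); congr (_ * _).
  apply: eq_bigr => u _; apply: eq_bigr => v _; rewrite pi qj ij mxE.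
  by case: (_ == _); rewrite ?mulr1 ?mulr0.
rewrite big1 ?mulr0 // => u _; rewrite big1 // => v _; rewrite pi qj !mxE.
by case: eqP => [->|]; rewrite ?mul0r // (negPf ij) mulr0.
Qed.

Let poly1 : poly_mx 1 A = dist_mx e R 0.
Proof. by rewrite poly_mx1 (dist_mx0 R e_irr). Qed.

Let polyX : poly_mx 'X A = dist_mx e R 1.
Proof. by rewrite poly_mxX (dist_mx1 R e_irr). Qed.

(** For the converse, [1], ['X] and [q] form an initial predistance segment by [spec_dot_dist], and
    this segment extends to a full family. *)
Lemma partially_distance_regular2P :
  partially_distance_regular theta m e k 2 <->
  exists2 q : {poly R}, size q = 3%N & poly_mx q A = dist_mx e R 2.
Proof.
have [th_decr m_gt0 _] := spec.
split=> [[_ [p [[szp _ _] pA]]]|[q szq qA]].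
  have i2 : (inord 2 : 'I_d.+1) = 2%N :> nat by rewrite inordK.
  by exists (p (inord 2)); rewrite ?szp ?pA ?i2.
split.
  (* The diameter is at least 2, since otherwise [q] would vanish at [A]. *)
  have : [exists u, exists v, gdist e u v == 2%N].
    apply: contraT => /existsPn no2.
    have A20 : dist_mx e R 2 = 0.
      apply/matrixP => i j; rewrite !mxE.
      by have /existsPn/(_ (enum_val j))/negPf -> := no2 (enum_val i).
    have q0 : q = 0.
      apply: (poly_mx_inj AT spec); rewrite ?szq ?size_poly0 //.
      by rewrite qA A20 -polyC0 poly_mxC raddf0.
    by move: szq; rewrite q0 size_poly0.
  case/existsP => u /existsP[v /eqP uv2]; rewrite -[X in (X <= _)%N]uv2.
  by rewrite (leq_trans _ (leq_bigmax u)) // (leq_bigmax v).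
pose f i : {poly R} := nth 0 [:: 1; 'X; q] i.
have fA i : (i < 3)%N -> poly_mx (f i) A = dist_mx e R i.
  by case: i => [|[|[|i]]].
have [||p pp pf] := predistance_complete th_decr m_gt0 n_gt0 theta0 (l := 3) (f := f).
- by [].
- split=> [i|i j i3 j3 ij|i i3].
  + by case: i => [|[|[|i]]] //= _; rewrite ?size_poly1 ?size_polyX.
  + by rewrite (spec_dot_dist (fA _ i3) (fA _ j3)) (negPf ij).
  + by rewrite (spec_dot_dist (fA _ i3) (fA _ i3)) eqxx.
by exists p; split=> // i i2; rewrite pf ?fA.
Qed.

(** Orthogonality of [q] to [1] and ['X], together with its normalization, gives three equations in
    its coefficients and the moments [C l]. Eliminating the two lower coefficients leaves the
    formula defining [gamma2]. *)
Lemma distance2_lead_coef (q : {poly R}) :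
  size q = 3%N -> poly_mx q A = dist_mx e R 2 ->
  gamma2 theta m n k != 0 /\ q`_2 = (gamma2 theta m n k)^-1.
Proof.
move=> szq qA; have [th_decr m_gt0 _] := spec.
pose C := avg_closed_walks theta m n.
have dotXq l : dot 'X^l q = q`_2 * C (l + 2)%N + q`_1 * C (l + 1)%N + q`_0 * C l.
  rewrite [q in dot _ q]quadraticE ?szq // !spec_dotDr !spec_dotZr !spec_dotXn.
  by rewrite addn0.
have C0 : C 0%N = 1.
  by rewrite /C -[0%N]/(0 + 0)%N -spec_dotXn expr0 (spec_dot_dist poly1 poly1) hornerC.
have C1 : C 1%N = 0.
  by rewrite /C -[1%N]/(0 + 1)%N -spec_dotXn expr0 expr1 (spec_dot_dist poly1 polyX).
have C2 : C 2%N = k%:R.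
  by rewrite /C -[2%N]/(1 + 1)%N -spec_dotXn expr1 (spec_dot_dist polyX polyX) hornerX.
have q1 : q`_2 * k%:R + q`_0 = 0.
  have := dotXq 0%N; rewrite expr0 (spec_dot_dist poly1 qA) /= !add0n C0 C1 C2.
  by rewrite mulr0 addr0 mulr1.
have qX : q`_2 * C 3%N + q`_1 * k%:R = 0.
  have := dotXq 1%N; rewrite expr1 (spec_dot_dist polyX qA) /= !add1n C1 C2.
  by rewrite mulr0 addr0.
have qk : q.[k%:R] = q`_2 * k%:R ^+ 2 + q`_1 * k%:R + q`_0.
  by rewrite horner_quadratic // szq.
(* Only the quadratic term of [q] contributes to [dot q q], by orthogonality to the lower
   degrees. *)
have qq : q`_2 * (q`_2 * C 4%N + q`_1 * C 3%N + q`_0 * k%:R) = q.[k%:R].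
  have -> : q`_2 * C 4%N + q`_1 * C 3%N + q`_0 * k%:R = dot q 'X^2.
    by rewrite spec_dotC dotXq C2.
  have dq1 : dot q 1 = 0 by rewrite (spec_dot_dist qA poly1).
  have dqX : dot q 'X = 0 by rewrite (spec_dot_dist qA polyX).
  transitivity (dot q q); last by rewrite (spec_dot_dist qA qA).
  rewrite [X in _ = dot _ X]quadraticE ?szq // !spec_dotDr !spec_dotZr.
  by rewrite expr0 expr1 dq1 dqX !mulr0 !addr0.
have a0 : q`_2 != 0.
  have : lead_coef q != 0 by rewrite lead_coef_eq0 -size_poly_gt0 szq.
  by rewrite /lead_coef szq.
have qk0 : q.[k%:R] != 0.
  rewrite -[q.[_]]/(if 2%N == 2%N then _ else 0) -(spec_dot_dist qA qA).
  apply: (spec_dot_neq0 th_decr m_gt0 n_gt0); last by rewrite szq.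
  by rewrite -size_poly_gt0 szq.
move: qq qk0; rewrite qk.
have -> : q`_0 = - (q`_2 * k%:R) by apply/eqP; rewrite -addr_eq0 addrC q1.
have b : q`_1 * k%:R = - (q`_2 * C 3%N) by apply/eqP; rewrite -addr_eq0 addrC qX.
have -> : q`_1 = - (q`_2 * C 3%N) / k%:R by rewrite -b mulfK.
rewrite divfK // => qq qk0.
(* Up to a nonzero factor, the denominator of [gamma2] is the nonzero number [q.[k%:R]]. *)
have den0 : k%:R * (C 3%N + k%:R - k%:R ^+ 2) != 0.
  rewrite mulf_neq0 //; apply: contraNneq qk0 => E.
  have -> : q`_2 * k%:R ^+ 2 - q`_2 * C 3%N - q`_2 * k%:R =
    - (q`_2 * (C 3%N + k%:R - k%:R ^+ 2)) by ring.
  by rewrite E mulr0 oppr0.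
(* This is [qq] multiplied by [- k], with one factor of the leading coefficient cancelled. *)
have num : q`_2 * (C 3%N ^+ 2 - C 4%N * k%:R + k%:R ^+ 3) =
    k%:R * (C 3%N + k%:R - k%:R ^+ 2).
  apply: (mulfI a0); move/(congr1 (fun x => - (k%:R * x))): qq.
  have -> : - (k%:R * (q`_2 * (q`_2 * C 4 + - (q`_2 * C 3) / k%:R * C 3
      + - (q`_2 * k%:R) * k%:R))) =
    q`_2 * (q`_2 * (C 3 ^+ 2 - C 4 * k%:R + k%:R ^+ 3)) by field.
  by move=> ->; ring.
have gE : gamma2 theta m n k = (q`_2)^-1.
  rewrite /gamma2 -/C -num invfM [X in _ * X]mulrC mulrA mulfV ?mul1r //.
  by apply: contraNneq den0 => E; rewrite -num E mulr0.
by rewrite gE invr_eq0 invrK.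
Qed.

End DistancePolynomial.

(** * Strongly regular graphs whose adjacency matrix is quadratic in that of a graph with five
    eigenvalues *)

(* If [a x^2 + b x + c] takes at most two values on [t1 > t2 > t3 > t4], it
   identifies these points in pairs symmetric about [- b / 2a], which can only
   be [{t1, t4}] and [{t2, t3}]. *)
Lemma quadratic_two_values (R : realFieldType) (a b c B D t1 t2 t3 t4 : R) :
  a != 0 -> t1 > t2 -> t2 > t3 -> t3 > t4 -> t1 + t4 = t2 + t3 ->
  (forall t, t \in [:: t1; t2; t3; t4] ->
     (a * t ^+ 2 + b * t + c) ^+ 2 = B * (a * t ^+ 2 + b * t + c) + D) ->
  b = - (t2 + t3) * a.
Proof.
move=> a0 t12 t23 t34 tsum w0; pose y t := a * t ^+ 2 + b * t + c.
have same s t : s != t -> y s = y t -> b = - (s + t) * a.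
  move=> st yst; apply/eqP; rewrite mulNr -addr_eq0; apply/eqP.
  have s_t : s - t != 0 by rewrite subr_eq0.
  apply: (mulfI s_t); rewrite mulr0 -(subrr (y t)) -{1}yst /y; ring.
have alt s t : s \in [:: t1; t2; t3; t4] -> t \in [:: t1; t2; t3; t4] ->
    y s = y t \/ y s + y t = B.
  move=> /w0; rewrite -/(y s) => ys /w0; rewrite -/(y t) => yt.
  have /eqP : (y s - y t) * (y s + y t - B) = 0.
    have -> : (y s - y t) * (y s + y t - B) =
      (y s ^+ 2 - B * y s) - (y t ^+ 2 - B * y t) by ring.
    rewrite ys yt; ring.
  rewrite mulf_eq0 !subr_eq0 => /orP[/eqP ->|/eqP ->]; [by left | by right].
have in1 : t1 \in [:: t1; t2; t3; t4] by rewrite !inE eqxx.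
have in2 : t2 \in [:: t1; t2; t3; t4] by rewrite !inE eqxx !orbT.
have in3 : t3 \in [:: t1; t2; t3; t4] by rewrite !inE eqxx !orbT.
have in4 : t4 \in [:: t1; t2; t3; t4] by rewrite !inE eqxx !orbT.
have uniq_sum s s' t t' : s != s' -> t != t' -> y s = y s' -> y t = y t' ->
    s + s' = t + t'.
  move=> ss tt /(same _ _ ss) b1 /(same _ _ tt).
  by rewrite b1 => /(mulIf a0)/oppr_inj.
have [y14|y14] := alt _ _ in1 in4.
  by rewrite -tsum; apply: same y14; rewrite gt_eqF // (lt_trans t34) // (lt_trans t23).
have [y23|y23] := alt _ _ in2 in3; first by apply: same y23; rewrite gt_eqF.
(* What remains is to exclude the pairings of [t1] with [t2] and of [t1] with [t3]: each leaves a
   second pair of equal values, and the resulting equality of sums contradicts the ordering. *)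
have [y12|y12] := alt _ _ in1 in2.
  have y34 : y t3 = y t4 by lra.
  have := uniq_sum _ _ _ _ (negbT (gt_eqF t12)) (negbT (gt_eqF t34)) y12 y34.
  lra.
have y13 : y t1 = y t3 by lra.
have y24 : y t2 = y t4 by lra.
have t13 := lt_trans t23 t12; have t24 := lt_trans t34 t23.
have := uniq_sum _ _ _ _ (negbT (gt_eqF t13)) (negbT (gt_eqF t24)) y13 y24.
lra.
Qed.

Section StronglyRegular.
Variables (R : rcfType) (V : finType) (e : rel V) (k : nat).
Variables (theta : 'I_5 -> R) (m : 'I_5 -> nat).
Hypotheses (e_sym : symmetric e) (e_irr : irreflexive e).
Hypotheses (e_conn : connected_graph e) (e_reg : regular_graph e k).
Hypotheses (spec : has_spectrum theta m (adj_mx e R)).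
Hypotheses (theta0 : theta 0 = k%:R).
Hypothesis theta_sum : theta 1 + theta 4 = theta 2 + theta 3.

Local Notation A := (adj_mx e R).
Local Notation n := #|V|.

Let AT := trmx_adj_mx R e_sym.

Lemma mem_I5 (i : 'I_5) : i \in [:: 0; 1; 2; 3; 4].
Proof. by case: i => [[|[|[|[|[|i]]]]] //= i5]; rewrite !inE -!val_eqE. Qed.

Let th12 : theta 1 > theta 2. Proof. by have [+ _ _] := spec; apply. Qed.
Let th23 : theta 2 > theta 3. Proof. by have [+ _ _] := spec; apply. Qed.
Let th34 : theta 3 > theta 4. Proof. by have [+ _ _] := spec; apply. Qed.

Lemma mul_ones_degree : A *m const_mx 1 = k%:R *: const_mx 1 :> 'M_n.
Proof.
apply/matrixP => i j; have /matrixP/(_ i 0) := adj_mx_ones R e_reg.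
by rewrite !mxE => <-; apply: eq_bigr => l _; rewrite !mxE.
Qed.

(* The all-ones vector spans the [k]-eigenspace of [A]. *)
Lemma poly_mx_const (p : {poly R}) :
  (exists c, poly_mx p A = const_mx c) <->
  forall i, i != 0 -> p.[theta i] = 0.
Proof.
split=> [[c pc] i i0|p0].
  have /(poly_mx_eq0P AT spec)/(_ i)/eqP : poly_mx (('X - k%:R%:P) * p) A = 0.
    rewrite poly_mxM pc.
    have -> : const_mx c = c *: const_mx 1 :> 'M_n.
      by apply/matrixP => j l; rewrite !mxE mulr1.
    rewrite -scalemxAr poly_mxB poly_mxX.
    by rewrite poly_mxC mulmxBl mul_ones_degree mul_scalar_mx subrr scaler0.
  rewrite hornerM hornerXsubC -theta0 mulf_eq0 subr_eq0.
  by rewrite (inj_eq (spectrum_inj spec)) (negPf i0) => /eqP.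
apply: (eigenmatrix_const e_sym e_conn e_reg); first exact: trmx_poly_mx.
apply/eqP; rewrite -subr_eq0 -mul_scalar_mx -mulmxBl -(poly_mxC A) -{1}[A]poly_mxX.
rewrite -poly_mxB -poly_mxM; apply/eqP/(poly_mx_eq0P AT spec) => i.
rewrite hornerM hornerXsubC; have [->|/p0 ->] := eqVneq i 0.
  by rewrite theta0 subrr mul0r.
by rewrite mulr0.
Qed.

Section PolynomialGraph.
Variables (f : rel V) (r : {poly R}).
Hypotheses (f_irr : irreflexive f) (r_size : size r = 3%N).
Hypothesis rA : poly_mx r A = adj_mx f R.

Let F := adj_mx f R.

Lemma polynomial_graph_sym : symmetric f.
Proof.
have FT : F^T = F by rewrite /F -rA trmx_poly_mx.
move=> u v; have /matrixP/(_ (enum_rank u) (enum_rank v)) := FT.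
rewrite !mxE !enum_rankK => /eqP; rewrite eqr_nat.
by case: (f u v); case: (f v u).
Qed.

Let common u v : (F *m F) (enum_rank u) (enum_rank v) =
  #|[set w | f u w && f v w]|%:R.
Proof.
rewrite natr_card_set mxE -[RHS]sum_enum_val; apply: eq_bigr => l _.
rewrite !mxE !enum_rankK (polynomial_graph_sym v).
by case: (f u _); case: (f _ v); rewrite ?mulr0 ?mulr1.
Qed.

Let r_lead : r`_2 != 0.
Proof.
have : lead_coef r != 0 by rewrite lead_coef_eq0 -size_poly_gt0 r_size.
by rewrite /lead_coef r_size.
Qed.

Lemma polynomial_graph_regular : exists l, regular_graph f l.
Proof.
have deg u : #|[set v | f u v]|%:R = r.[k%:R].
  rewrite -(poly_mx_row_sum e_reg _ (enum_rank u)) rA natr_card_set.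
  rewrite -[LHS]sum_enum_val; apply: eq_bigr => j _.
  by rewrite !mxE enum_rankK.
case: (pickP V) => [u _|V0]; last by exists 0%N => u; have := V0 u.
exists #|[set v | f u v]| => v; apply/eqP; rewrite -(eqr_nat R).
by rewrite !deg.
Qed.

Lemma polynomial_graph_edge : exists u v, f u v.
Proof.
case: (boolP [exists u, exists v, f u v]) => [/existsP[u /existsP[v uv]]|/existsPn no].
  by exists u, v.
have r0 : r = 0.
  apply: (poly_mx_inj AT spec); rewrite ?r_size ?size_poly0 //.
  rewrite rA -polyC0 poly_mxC raddf0; apply/matrixP => i j; rewrite !mxE.
  by have /existsPn/(_ (enum_val j))/negPf -> := no (enum_val i).
by move: r_size; rewrite r0 size_poly0.
Qed.

(** If [f] were complete, [r + 1] would send [A] to the all-ones matrix, and this quadratic would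
    vanish at every eigenvalue other than [k]. *)
Lemma polynomial_graph_nonedge : exists u v, u != v /\ ~~ f u v.
Proof.
case: (boolP [exists u, exists v, (u != v) && ~~ f u v]) =>
  [/existsP[u /existsP[v /andP[uv fuv]]]|/existsPn no]; first by exists u, v.
have rJ : poly_mx (r + 1) A = const_mx 1.
  rewrite poly_mxD poly_mx1 rA; apply/matrixP => i j; rewrite !mxE.
  have /existsPn/(_ (enum_val j)) := no (enum_val i).
  rewrite (inj_eq enum_val_inj) negb_and !negbK; case: eqVneq => [->|_ /= ->].
    by rewrite f_irr add0r.
  by rewrite addr0.
have szr1 : size (r + 1) = 3%N by rewrite size_polyDl r_size // size_poly1.
have r0 i : i != 0 -> (r + 1).[theta i] = 0.
  by move: i; apply/poly_mx_const; exists 1.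
have : r + 1 = 0.
  apply: (@roots_geq_poly_eq0 _ _ [:: theta 1; theta 2; theta 3]).
  - by rewrite /= /root !r0 // eqxx.
  - have th13 := lt_trans th23 th12.
    by rewrite /= !inE !negb_or (gt_eqF th12) (gt_eqF th13) (gt_eqF th23).
  - by rewrite szr1.
by move/eqP; rewrite -size_poly_eq0 szr1.
Qed.

(** Strong regularity is a quadratic relation for [F] up to a multiple of the all-ones matrix. By
    [poly_mx_const] it says that [r] takes at most two values on the eigenvalues other than [k],
    which fixes the axis of the parabola. *)
Lemma polynomial_graph_srgP :
  strongly_regular f <-> r`_1 = - (theta 2 + theta 3) * r`_2.
Proof.
have rE x : r.[x] = r`_2 * x ^+ 2 + r`_1 * x + r`_0.
  by rewrite horner_quadratic // r_size.
split=> [[[l reg] _ _ [a [c srg]]]|sym].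
  (* Here [l], [a] and [c] are the degree and the two numbers of common neighbours; subtracting [c]
     from every entry of [F *m F] leaves a combination of [F] and the identity. *)
  have /poly_mx_const w0 : exists b, poly_mx (r ^+ 2 - (a%:R - c%:R) *: r
      - (l%:R - c%:R)%:P) A = const_mx b.
    exists c%:R; rewrite !poly_mxB poly_mxZ poly_mxC expr2 poly_mxM rA -/F.
    apply/matrixP => i j; rewrite -(enum_valK i) -(enum_valK j).
    move: (enum_val i) (enum_val j) => u v; rewrite [LHS]mxE [X in X + _]mxE common.
    rewrite !mxE !enum_rankK (inj_eq enum_rank_inj).
    have [<-|uv] := eqVneq u v.
      rewrite f_irr -(reg u) (eq_card (B := [set w | f u w])) => [|w].
        by rewrite mulr1n /= mulr0n; ring.
      by rewrite !inE andbb.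
    by rewrite srg // mulr0n; case: (f u v); rewrite /= ?mulr0n ?mulr1n; ring.
  apply: (quadratic_two_values (c := r`_0) (B := a%:R - c%:R) (D := l%:R - c%:R)
    r_lead th12 th23 th34 theta_sum) => t.
  have w0E i : i != 0 -> r.[theta i] ^+ 2 = (a%:R - c%:R) * r.[theta i] + (l%:R - c%:R).
    move/w0; rewrite !hornerD !hornerN horner_exp hornerZ hornerC => /eqP.
    by rewrite subr_eq0 subr_eq addrC => /eqP.
  by rewrite !inE => /or4P[] /eqP ->; rewrite -rE; apply: w0E.
(* By [theta_sum] the axis is also the midpoint of [theta 1] and [theta 4], so [r] takes only the
   values [x] and [y] there. *)
have r14 : r.[theta 4] = r.[theta 1].
  rewrite !rE sym -theta_sum; ring.
have r23 : r.[theta 3] = r.[theta 2] by rewrite !rE sym; ring.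
pose x := r.[theta 1]; pose y := r.[theta 2].
have [c pc] : exists c, poly_mx ((r - x%:P) * (r - y%:P)) A = const_mx c.
  apply/poly_mx_const => i; rewrite hornerM !hornerD !hornerN !hornerC.
  have := mem_I5 i; rewrite !inE; case: eqVneq => //= _ + _.
  by case/or4P=> /eqP ->; rewrite ?r14 ?r23 /x /y subrr ?mul0r ?mulr0.
have FF u v : u != v ->
    #|[set w | f u w && f v w]|%:R = (x + y) * (f u v)%:R + c.
  move=> uv; rewrite -common.
  have -> : F *m F = const_mx c + (x + y) *: F - (x * y)%:M.
    rewrite -pc poly_mxM !poly_mxB !poly_mxC rA -/F mulmxBl !mulmxBr.
    rewrite mul_scalar_mx mul_mx_scalar mul_scalar_mx scale_scalar_mx scalerDl.
    by apply/matrixP => i j; rewrite !mxE; ring.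
  rewrite !mxE !enum_rankK (inj_eq enum_rank_inj) (negPf uv) mulr0n; ring.
have [u1 [v1 f1]] := polynomial_graph_edge.
have [u2 [v2 [uv2 f2]]] := polynomial_graph_nonedge.
have uv1 : u1 != v1 by apply: contraTneq f1 => ->; rewrite f_irr.
split; [exact: polynomial_graph_regular | by exists u2, v2 | by exists u1, v1 |].
(* The formula [FF] has its parameters in [R]; the natural numbers required are obtained as the
   counts at one edge and at one non-edge. *)
exists #|[set w | f u1 w && f v1 w]|, #|[set w | f u2 w && f v2 w]| => u v uv.
apply/eqP; rewrite -(eqr_nat R) FF //; case: ifP => fuv; rewrite FF //.
  by rewrite f1.
by rewrite (negPf f2).
Qed.

End PolynomialGraph.

(** * Equality in the bound *)

(** Solving [s(A) - t I = a (I + A + A_2)] for [A_2] gives a quadratic [q] with leading coefficient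
    [a^-1]. By [distance2_lead_coef] the scalar [a] must be [gamma2], which determines the linear
    coefficient. *)
Lemma bound_eqP (b c : R) :
  let s := 'X^2 - b *: 'X + c%:P in
  m 0 = 1%N ->
  avg_ball2_size e R = Phi theta m n s (tau_opt theta m n s) <->
  exists q : {poly R}, [/\ size q = 3%N, poly_mx q A = dist_mx e R 2
    & q`_1 = - (b + gamma2 theta m n k) * q`_2].
Proof.
move=> s m0; set g := gamma2 _ _ _ _.
have n_gt2 := spectrum_card_gt2 spec (isT : (1 < 4)%N).
have s_size : size s = 3%N by apply: size_quadratic.
have Phi_eq t := Phi_eq_avgP e_sym e_irr e_reg spec theta0 isT t s_size.
split=> [/Phi_eq|[q [q_size qA q1]]].
  set t := tau_opt _ _ _ _ => -[a sa].
  have a0 : a != 0.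
    apply: contraNneq (poly_mx_sub_neq0 e_sym spec isT t s_size) => a0.
    by rewrite sa a0 scale0r.
  pose q := a^-1 *: (s - t%:P) - ('X + 1).
  have qA : poly_mx q A = dist_mx e R 2.
    rewrite poly_mxB poly_mxD poly_mxZ sa scalerA mulVf // scale1r poly_mxX poly_mx1.
    by rewrite (ball2_mxE R e_irr n_gt2); apply/matrixP => i j; rewrite !mxE; ring.
  have q_coef : (q`_2 = a^-1) * (q`_1 = - a^-1 * b - 1).
    split; rewrite !(coefB, coefD, coefZ, coefC, coefX, coefXn, coef1) /=; ring.
  have q_size : size q = 3%N.
    have st_size : size (a^-1 *: (s - t%:P)) = 3%N.
      rewrite size_scale ?invr_eq0 // size_polyDl // size_polyN s_size.
      exact: leq_ltn_trans (size_polyC_leq1 _) _.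
    by rewrite size_polyDl // size_polyN st_size -polyC1 size_XaddC.
  exists q; split=> //.
  have [g0] := distance2_lead_coef e_sym e_irr e_reg spec isT q_size qA.
  rewrite -/g !q_coef => /invr_inj <-; field; exact: a0.
have [g0 q2] := distance2_lead_coef e_sym e_irr e_reg spec isT q_size qA.
rewrite -/g in g0 q2.
(* Chosen so that the constant coefficients of [s - t%:P] and [g *: (q + 'X + 1)] agree. *)
pose t := c - g * q`_0 - g.
have sa : poly_mx (s - t%:P) A = g *: ball2_mx R e.
  have -> : s - t%:P = g *: (q + 'X + 1).
    rewrite [q in RHS]quadraticE ?q_size //.
    rewrite q1 q2 expr1 expr0 /s; apply/polyP => i.
    rewrite !(coefB, coefD, coefZ, coefC, coefX, coefXn, coef1) /t.
    by case: i => [|[|[|i]]] /=; field.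
  rewrite poly_mxZ !poly_mxD poly_mxX poly_mx1 qA.
  by rewrite (ball2_mxE R e_irr n_gt2); congr (_ *: _);
    rewrite [LHS]addrC [X in _ + X]addrC addrA.
rewrite (tau_optE e_sym e_irr e_reg spec theta0 isT s_size m0 sa).
by apply/Phi_eq; exists g.
Qed.

(** The graph [f] comes from the polynomial [q + eps *: 'X]; with the leading coefficient of [q]
    equal to the inverse of [gamma2], the stated value of [b] makes the conditions of
    [polynomial_graph_srgP] and [bound_eqP] coincide. The values 0 and 1 of [eps] give the
    distance-2 and the distance-1-or-2 graph. *)
Lemma bound_eq_srgP (f : rel V) (eps b c : R) :
  let s := 'X^2 - b *: 'X + c%:P in
  m 0 = 1%N -> irreflexive f ->
  adj_mx f R = dist_mx e R 2 + eps *: A ->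
  b = theta 2 + theta 3 - (1 - eps) * gamma2 theta m n k ->
  avg_ball2_size e R = Phi theta m n s (tau_opt theta m n s) <->
  partially_distance_regular theta m e k 2 /\ strongly_regular f.
Proof.
move=> s m0 f_irr fE bE; rewrite bound_eqP //.
rewrite (partially_distance_regular2P e_sym e_irr e_reg spec theta0 isT).
have coef_srgP (q : {poly R}) : size q = 3%N -> poly_mx q A = dist_mx e R 2 ->
    strongly_regular f <-> q`_1 = - (b + gamma2 theta m n k) * q`_2.
  move=> q_size qA; pose r := q + eps *: 'X.
  have X_size : (size (eps *: 'X : {poly R}) < 3)%N.
    by rewrite (leq_ltn_trans (size_scale_leq _ _)) ?size_polyX.
  have r_size : size r = 3%N by rewrite size_polyDl q_size.
  have rA : poly_mx r A = adj_mx f R by rewrite poly_mxD poly_mxZ poly_mxX qA.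
  rewrite (polynomial_graph_srgP f_irr r_size rA) !coefD !coefZ !coefX mulr1 mulr0.
  have [g0 ->] := distance2_lead_coef e_sym e_irr e_reg spec isT q_size qA.
  rewrite addr0 bE; split=> [E|->]; last by field.
  by apply: (addIr eps); rewrite E; field.
split=> [[q [q_size qA q1]]|[[q q_size qA] srg]].
  by split; [exists q | apply/(coef_srgP q)].
by exists q; split=> //; apply/coef_srgP.
Qed.

End StronglyRegular.

Theorem theorem10 (R : rcfType) (V : finType) (e : rel V) (k : nat)
    (theta : 'I_5 -> R) (m : 'I_5 -> nat)
    (e_sym : symmetric e) (e_irr : irreflexive e)
    (e_conn : connected_graph e) (e_reg : regular_graph e k)
    (spec : has_spectrum theta m (adj_mx e R))
    (theta0 : theta 0 = k%:R) (m0 : m 0 = 1%N)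
    (theta_sum : theta 1 + theta 4 = theta 2 + theta 3) :
  let n := #|V| in
  let g := gamma2 theta m n k in
  let bound s := Phi theta m n s (tau_opt theta m n s) in
  [/\ bound (s1 theta g) <= avg_ball2_size e R,
      bound (s2 theta g) <= avg_ball2_size e R,
      avg_ball2_size e R = bound (s1 theta g) <->
        partially_distance_regular theta m e k 2
        /\ strongly_regular (dist2_graph e)
    & avg_ball2_size e R = bound (s2 theta g) <->
        partially_distance_regular theta m e k 2
        /\ strongly_regular (dist12_graph e)].
Proof.
move=> n g bound.
have th0 : theta ord0 = k%:R by [].
have n_gt2 := spectrum_card_gt2 spec (isT : (1 < 4)%N).
have quad_size b c : size ('X^2 - b *: 'X + c%:P : {poly R}) = 3%N.
  exact: size_quadratic.
split.
- by apply: (Phi_le_avg e_sym e_irr e_reg spec th0) => //; apply: quad_size.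
- by apply: (Phi_le_avg e_sym e_irr e_reg spec th0) => //; apply: quad_size.
- apply: (bound_eq_srgP e_sym e_irr e_conn e_reg spec theta0 theta_sum (eps := 0)) => //.
  + by move=> u; apply/eqP; rewrite /dist2_graph (gdist_diag e_irr n_gt2).
  + by rewrite scale0r addr0; apply/matrixP => i j; rewrite !mxE.
  + by rewrite subr0 mul1r.
- apply: (bound_eq_srgP e_sym e_irr e_conn e_reg spec theta0 theta_sum (eps := 1)) => //.
  + by move=> u; rewrite /dist12_graph gdist1 // e_irr (gdist_diag e_irr n_gt2).
  + rewrite scale1r -(dist_mx1 R e_irr n_gt2); apply/matrixP => i j.
    rewrite !mxE /dist12_graph; case: (gdist _ _ _) => [|[|[|l]]];
      by rewrite /= ?addr0 ?add0r.
  + by rewrite subrr mul0r subr0.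
Qed.
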